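(* Let $k$ be a positive integer and, for each $n\ge 1$, let $w_{n,k}$ denote the number of words $w_1\cdots w_n$ with all $w_i\in[n]$ that contain no strictly decreasing subsequence of length $k+1$ (i.e. there are no indices $i_1<\dots<i_{k+1}$ with $w_{i_1}>w_{i_2}>\dots>w_{i_{k+1}}$). Then the limit $\lim_{n\to\infty} w_{n,k}^{1/n}$ exists and \[\limsup_{n\to\infty} w_{n,k}^{1/n} = \frac{(k+1)^{k+1}}{k^{k-1}}.\]
   Context: $[n]=\{1,2,\dots,n\}$. *)

(* Defs.v *)
From HB Require Import structures.
From mathcomp Require Import all_boot all_order all_algebra.
From mathcomp Require Import all_classical all_reals all_analysis.
Set Implicit Arguments. Unset Strict Implicit. Unset Printing Implicit Defensive.
Import Order.TTheory GRing.Theory Num.Theory.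

(* A word of length n over the alphabet [n] is encoded as w : {ffun 'I_n -> 'I_n};
   letter j : 'I_n stands for j+1 \in [n] (an order isomorphism, so decreasing
   subsequences are unaffected). Positions are likewise 0-based. *)

Definition has_dec_subseq (n m : nat) (w : {ffun 'I_n -> 'I_n}) : bool :=
  [exists f : {ffun 'I_m -> 'I_n},
     [forall i : 'I_m, forall j : 'I_m,
        (i < j)%N ==> ((f i < f j)%N && (w (f j) < w (f i))%N)]].

Definition wnk (n k : nat) : nat :=
  #|[set w : {ffun 'I_n -> 'I_n} | ~~ has_dec_subseq k.+1 w]|.

(* Main.v *)
Require Import Defs.
From HB Require Import structures.
From mathcomp Require Import all_boot all_order all_algebra.
From mathcomp Require Import all_classical all_reals all_analysis.
From mathcomp Require Import zify ring lra.
Set Implicit Arguments. Unset Strict Implicit. Unset Printing Implicit Defensive.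
Import Order.TTheory GRing.Theory Num.Theory.

(* Call a k-coloured word of length n over A letters a word with a k-colouring of
   its positions whose colour classes are weakly increasing; let N(n, k, A) be
   their number.  A word has no strictly decreasing subsequence of length k+1
   iff it admits such a colouring.

   Upper bound: given the colouring, the word is determined by the multiset of
   its (colour, letter) pairs, so w_{n,k} <= N(n, k, n) <= k^n C(n + kn, n), and
   k^{kn} C((k+1)n, n) <= (k+1)^{(k+1)n} by the binomial theorem.

   Lower bound: a coloured word cannot in general be recovered from its word.
   Cut the positions into T blocks of length B and the alphabet into blocks of
   size A, put an arbitrary coloured word in each position block, and draw the
   letters of colour a in position block p from the alphabet block p + a.  Each
   colour class stays weakly increasing and the colours can now be read off the
   letters, so N(B, k, A)^T <= w_{n,k} as soon as (T + k)A <= n and TB <= n.  With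
   B = kb and A = kb + 1, counting only colourings whose classes all have size b
   gives N(B, k, A) >= (kb)! / (b!)^k * C(b + kb, b)^k, which by Stirling-type
   bounds has the required exponential growth rate. *)

(** * Coloured words and words without long decreasing subsequences *)

Definition increasing_on_classes (n k A : nat)
    (cx : {ffun 'I_n -> 'I_k} * {ffun 'I_n -> 'I_A}) : bool :=
  [forall i : 'I_n, forall j : 'I_n,
     (i < j) && (cx.1 i == cx.1 j) ==> (cx.2 i <= cx.2 j)].

Lemma increasing_on_classesP (n k A : nat)
    (c : {ffun 'I_n -> 'I_k}) (x : {ffun 'I_n -> 'I_A}) :
  reflect (forall i j : 'I_n, i < j -> c i = c j -> x i <= x j)
          (increasing_on_classes (c, x)).
Proof.
apply: (iffP forallP) => [H i j ij cij | H i].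
  by have /forallP/(_ j)/implyP := H i; apply; rewrite ij cij eqxx.
by apply/forallP => j; apply/implyP => /andP[ij /eqP cij]; apply: H.
Qed.

Definition ncoloured (n k A : nat) : nat :=
  #|[set cx : {ffun 'I_n -> 'I_k} * {ffun 'I_n -> 'I_A}
      | increasing_on_classes cx]|.

(** [m] counts steps: the decreasing subsequence has [m.+1] letters, the last one at position
    [i]. *)
Fixpoint ends_dec (n : nat) (w : {ffun 'I_n -> 'I_n}) (m : nat) (i : 'I_n) : bool :=
  if m is m'.+1 then [exists j : 'I_n, [&& j < i, w i < w j & ends_dec w m' j]]
  else true.

Lemma ends_dec_has_dec_subseq (n m : nat) (w : {ffun 'I_n -> 'I_n}) (i : 'I_n) :
  ends_dec w m i -> has_dec_subseq m.+1 w.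
Proof.
move=> H; have [f Hf _] : exists2 f : nat -> 'I_n,
    forall a b : nat, a < b <= m -> (f a < f b) && (w (f b) < w (f a)) & f m = i.
  elim: m i H => [|m IH] i /=; first by exists (fun=> i) => // a b; lia.
  case/existsP => j /and3P[ji wij /IH[f Hf fm]].
  exists (fun a => if a <= m then f a else i) => [a b|]; last by rewrite ltnn.
  case: (leqP b m) => [bm ab | mb ab].
    by rewrite ifT; [apply: Hf|]; lia.
  rewrite ifT; last by lia.
  have [am|am] := eqVneq a m; first by rewrite am fm ji wij.
  have /Hf/andP[] : a < m <= m by lia.
  by rewrite fm => h1 h2; rewrite (ltn_trans h1 ji) (ltn_trans wij h2).
apply/existsP; exists [ffun a : 'I_m.+1 => f a].
apply/forallP => a; apply/forallP => b; apply/implyP => ab; rewrite !ffunE.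
by apply: Hf; rewrite ab -ltnS ltn_ord.
Qed.

(* Colour a position by the length of the longest strictly decreasing
   subsequence ending there. *)
Lemma dec_free_colouring (n k : nat) (w : {ffun 'I_n -> 'I_n}) : 0 < k ->
  ~~ has_dec_subseq k.+1 w =
  [exists c : {ffun 'I_n -> 'I_k}, increasing_on_classes (c, w)].
Proof.
case: k => // k _; apply/idP/existsP => [Hw | [c /increasing_on_classesP Hc]].
  exists [ffun i => [arg max_(m > ord0 : 'I_k.+1 | ends_dec w m i) m]].
  apply/increasing_on_classesP => i j ij; rewrite !ffunE.
  case: arg_maxnP => // a Da _; case: arg_maxnP => // b Db maxb ab.
  rewrite leqNgt; apply: contraNN Hw => wji.
  have Dj : ends_dec w a.+1 j by apply/existsP; exists i; rewrite ij wji.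
  (* If [a < k], then [a.+1] contradicts the maximality of the colour of [j]; if [a = k], position
     [j] ends a decreasing subsequence with one letter more than there are colours. *)
  have [ak|ka] := ltnP a k.
    by have /= := maxb (Ordinal (ak : a.+1 < k.+1)) Dj; move: (congr1 val ab) => /=; lia.
  apply: (@ends_dec_has_dec_subseq _ _ _ j).
  by have <- : (a : nat) = k by have := ltn_ord a; lia.
apply/existsP => -[f /forallP Hf].
(* Pigeonhole: two letters of the decreasing subsequence share a colour. *)
have : ~~ injectiveb [ffun a : 'I_k.+2 => c (f a)].
  by apply/negP => /injectiveP /leq_card; rewrite !card_ord ltnn.
case/injectivePn => a [b ab]; rewrite !ffunE => cab.
wlog lab : a b ab cab / a < b.
  move=> H; case: (ltngtP a b) => [|ba|/val_inj ba]; first exact: H.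
    by apply: (H b a) => //; rewrite eq_sym.
  by rewrite ba eqxx in ab.
have /forallP/(_ b)/implyP/(_ lab)/andP[fab wab] := Hf a.
by have := Hc _ _ fab cab; rewrite leqNgt wab.
Qed.

(** * Upper bound *)

Lemma wnk_le_ncoloured (n k : nat) : 0 < k -> wnk n k <= ncoloured n k n.
Proof.
move=> k0; apply: leq_trans (leq_imset_card (@snd _ _) _).
apply/subset_leq_card/fintype.subsetP => w; rewrite !inE dec_free_colouring //.
by case/existsP => c Hc; apply/imsetP; exists (c, w); rewrite ?inE.
Qed.

Lemma wnk_gt0 (n k : nat) : 0 < k -> 0 < wnk n k.
Proof.
case: k => // k _; apply/card_gt0P; exists [ffun i => i].
rewrite inE dec_free_colouring //; apply/existsP; exists [ffun=> ord0].
by apply/increasing_on_classesP => i j /ltnW; rewrite !ffunE.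
Qed.

(* Given the colouring [c], the word is recovered from the multiset of pairs
   (colour, letter), encoded as the numbers [c i * A + x i]. *)
Definition code_multiset (n k A : nat)
    (cx : {ffun 'I_n -> 'I_k} * {ffun 'I_n -> 'I_A}) : n.-tuple 'I_(k * A).+1 :=
  [tuple of sort (relpre val leq) [tuple (inord (cx.1 i * A + cx.2 i) : 'I_(k * A).+1) | i < n]].

Lemma code_lt (k A : nat) (c : 'I_k) (x : 'I_A) : c * A + x < (k * A).+1.
Proof. by have := ltn_ord c; have := ltn_ord x; nia. Qed.

(** Codes of colour [a] lie in the interval of length [A] starting at [a * A], so the multiset
    reveals how many letters of each colour are at most [l]. *)
Lemma code_multiset_count (n k A : nat)
    (cx : {ffun 'I_n -> 'I_k} * {ffun 'I_n -> 'I_A}) (a l : nat) : l < A ->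
  count (fun y : 'I_(k * A).+1 => a * A <= y <= a * A + l) (code_multiset cx) =
  #|[set j | (cx.1 j == a :> nat) && (cx.2 j <= l)]|.
Proof.
move=> lA; rewrite /code_multiset /= count_sort count_map cardsE cardE.
rewrite [in RHS]/enum_mem size_filter -enumT; apply: eq_count => j /=.
rewrite [RHS]inE inordK ?code_lt //; have := ltn_ord (cx.2 j).
move: (nat_of_ord _) (nat_of_ord _) => u v vA.
have [ua|au|->] := ltngtP u a; last by rewrite leq_addr leq_add2l.
  by have := leq_mul ua (leqnn A); rewrite mulSn; lia.
by have := leq_mul au (leqnn A); rewrite mulSn; lia.
Qed.

(** Suppose [x i < y i]. Positions of colour [c i] whose letter in [y] is at most [x i] all precede
    [i], so their letter in [x] is at most [x i] too; [i] itself counts only for [x], hence the two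
    counts differ. *)
Lemma code_multiset_inj (n k A : nat) (c : {ffun 'I_n -> 'I_k})
    (x y : {ffun 'I_n -> 'I_A}) :
  increasing_on_classes (c, x) -> increasing_on_classes (c, y) ->
  code_multiset (c, x) = code_multiset (c, y) -> x = y.
Proof.
move=> Hx Hy E; apply/ffunP => i; apply/eqP; apply/negPn/negP => xy.
wlog lxy : x y Hx Hy E xy / x i < y i.
  move=> H; case: (ltngtP (x i) (y i)) => [|yx|/val_inj e]; first exact: H Hx Hy E xy.
    by apply: (H y x) => //; rewrite eq_sym.
  by rewrite e eqxx in xy.
have := code_multiset_count (c, x) (c i) (ltn_ord (x i)).
rewrite E code_multiset_count //= => /eqP; rewrite eqn_leq => /andP[_].
apply/negP; rewrite -ltnNge; apply: proper_card; apply/properP; split.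
  apply/fintype.subsetP => j; rewrite !inE => /andP[/eqP/val_inj cj yj]; rewrite cj eqxx /=.
  have ji : j < i.
    rewrite ltnNge; apply/negP; rewrite leq_eqVlt => /orP[/eqP/val_inj e|ij].
      by move: yj lxy; rewrite -e; lia.
    by have /increasing_on_classesP/(_ i j ij (esym cj)) := Hy; lia.
  by have /increasing_on_classesP/(_ j i ji cj) := Hx.
by exists i; rewrite !inE eqxx /= ?leqnn // -ltnNge.
Qed.

Lemma ncoloured_le (n k A : nat) :
  ncoloured n k A <= k ^ n * 'C(n + k * A, n).
Proof.
(* Codes range over [k * A + 1] values, one to spare, which gives exactly this binomial. *)
rewrite -card_sorted_tuples.
have -> : k ^ n = #|[set: {ffun 'I_n -> 'I_k}]| by rewrite cardsT card_ffun !card_ord.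
rewrite -cardsX.
rewrite /ncoloured -(@card_in_imset _ _ (fun cx => (cx.1, code_multiset cx))).
  apply/subset_leq_card/fintype.subsetP => ct /imsetP[[c x] _ ->] /=.
  rewrite !inE /= sorted_map /=; apply: sort_sorted => i j; exact: leq_total.
move=> [c x] [d y]; rewrite !inE /= => Hx Hy [e]; rewrite -{}e in Hy * => E.
by congr (_, _); apply: code_multiset_inj Hx Hy _; apply: val_inj.
Qed.

Lemma wnk_upper (n k : nat) : 0 < k ->
  wnk n k * k ^ (k.-1 * n) <= k.+1 ^ (k.+1 * n).
Proof.
move=> k0; have H := leq_trans (wnk_le_ncoloured n k0) (ncoloured_le n k n).
apply: leq_trans (leq_mul H (leqnn _)) _.
rewrite mulnAC -expnD -[n + k.-1 * n]mulSn prednK // mulnC -mulSn.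
rewrite -[k.+1 ^ _]/((1 + k) ^ _) addnC expnDn.
(* Of the binomial expansion only the term of index [n] is kept. *)
have i0 : n < (k.+1 * n).+1 by rewrite ltnS leq_pmull.
rewrite (bigD1 (Ordinal i0)) //= exp1n muln1 (_ : k.+1 * n - n = k * n).
  exact: leq_addr.
by rewrite mulSn addKn.
Qed.

(** * Gluing coloured words into one word *)

(* The colour is recovered as the difference of alphabet block and position block. *)
Definition glued_word (n k B A T : nat)
    (g : {ffun 'I_T -> {ffun 'I_B.+1 -> 'I_k} * {ffun 'I_B.+1 -> 'I_A}}) :
    {ffun 'I_n.+1 -> 'I_n.+1} :=
  [ffun i : 'I_n.+1 =>
     if insub (i %/ B.+1) : option 'I_T is Some p
     then let q := inord (i %% B.+1) in inord ((p + (g p).1 q) * A + (g p).2 q)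
     else ord_max].

Lemma glued_letter_lt (n k A T : nat) (p : 'I_T) (a : 'I_k) (x : 'I_A) :
  (T + k) * A <= n.+1 -> (p + a) * A + x < n.+1.
Proof.
move=> H; apply: leq_trans H.
have : (p + a).+1 * A <= (T + k) * A.
  by apply: leq_mul => //; have := ltn_ord p; have := ltn_ord a; lia.
by rewrite mulSn; have := ltn_ord x; lia.
Qed.

Lemma glued_wordE (n k B A T : nat)
    (g : {ffun 'I_T -> {ffun 'I_B.+1 -> 'I_k} * {ffun 'I_B.+1 -> 'I_A}})
    (i : 'I_n.+1) (p : 'I_T) (q : 'I_B.+1) :
  (T + k) * A <= n.+1 -> i = p * B.+1 + q :> nat ->
  glued_word n g i = (p + (g p).1 q) * A + (g p).2 q :> nat.
Proof.
move=> HA Hi; rewrite ffunE Hi divnMDl // modnMDl divn_small // modn_small //.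
by rewrite addn0 valK /= inord_val inordK // glued_letter_lt.
Qed.

Lemma glued_word_inj (n k B A T : nat) :
  (T + k) * A <= n.+1 -> T * B.+1 <= n.+1 -> injective (@glued_word n k B A T).
Proof.
move=> HA HB g h E; apply/ffunP => p.
have Hpq (q : 'I_B.+1) : p * B.+1 + q < n.+1.
  apply: leq_trans HB; have : p.+1 * B.+1 <= T * B.+1 by apply: leq_mul.
  by rewrite mulSn; have := ltn_ord q; lia.
have H q : (g p).1 q = (h p).1 q /\ (g p).2 q = (h p).2 q.
  have /(congr1 val) /= := congr1 (fun w : {ffun 'I_n.+1 -> 'I_n.+1} => w (Ordinal (Hpq q))) E.
  rewrite !(@glued_wordE _ _ _ _ _ _ _ p q) // => e.
  have A0 : 0 < A by apply: leq_trans (ltn_ord ((g p).2 q)).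
  (* The remainder modulo [A] is the letter; the quotient is [p] plus the colour. *)
  have := congr1 (divn^~ A) e; have := congr1 (modn^~ A) e.
  rewrite !modnMDl !divnMDl // !modn_small // !divn_small // !addn0 => e2 /addnI e1.
  by split; apply: val_inj.
rewrite [g p]surjective_pairing [h p]surjective_pairing.
by congr (_, _); apply/ffunP => q; have [] := H q.
Qed.

(** The block colourings combine: inside a block [Hg] applies, and within one colour a later
    position block uses a later alphabet block. *)
Lemma glued_word_dec_free (n k B A T : nat)
    (g : {ffun 'I_T -> {ffun 'I_B.+1 -> 'I_k} * {ffun 'I_B.+1 -> 'I_A}}) :
  0 < k -> (T + k) * A <= n.+1 -> (forall p, increasing_on_classes (g p)) ->
  ~~ has_dec_subseq k.+1 (glued_word n g).
Proof.
case: k g => // k g _ HA Hg; rewrite dec_free_colouring //; apply/existsP.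
(* Positions after the last block carry the largest letter, so they can safely join colour
   [ord0]. *)
exists [ffun i : 'I_n.+1 => if insub (i %/ B.+1) : option 'I_T is Some p
                           then (g p).1 (inord (i %% B.+1)) else ord0].
apply/increasing_on_classesP => i j ij; rewrite !ffunE.
have [pj Hj ej|_ _] := insubP _ (j %/ B.+1); last by rewrite -ltnS.
have ij' := leq_div2r B.+1 (ltnW ij).
have [pi Hi ei|] := insubP _ (i %/ B.+1); last by rewrite (leq_ltn_trans ij').
set qi := inord _; set qj := inord _ => ec /=.
rewrite !inordK ?glued_letter_lt // ec.
have : pi <= pj by rewrite ei ej.
rewrite leq_eqVlt => /orP[/eqP/val_inj e|lp]; last first.
  have : (pi + (g pj).1 qj).+1 * A <= (pj + (g pj).1 qj) * A by apply: leq_mul; lia.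
  by rewrite mulSn; have := ltn_ord ((g pi).2 qi); lia.
subst pj; rewrite leq_add2l.
have := Hg pi; rewrite [g pi]surjective_pairing => /increasing_on_classesP H; apply: H => //.
rewrite !inordK ?ltn_pmod //.
by rewrite -(ltn_add2l (pi * B.+1)) {1}ei ej -!divn_eq.
Qed.

Lemma ncoloured_pow_le_wnk (n k B A T : nat) :
  0 < k -> 0 < B -> 0 < A -> (T + k) * A <= n -> T * B <= n ->
  ncoloured B k A ^ T <= wnk n k.
Proof.
case: B => // B k0 _ A0; case: n => [|n] HA HB.
  by move: HA; rewrite leqn0 muln_eq0 addn_eq0 => /orP[/andP[_ /eqP ?]|/eqP ?]; lia.
rewrite /ncoloured -[T in _ ^ T]card_ord -card_ffun_on.
rewrite -(card_imset _ (@glued_word_inj _ _ _ _ _ HA HB)).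
apply/subset_leq_card/fintype.subsetP => w /imsetP[g /ffun_onP Hg ->].
by rewrite inE glued_word_dec_free // => p; have := Hg p; rewrite inE.
Qed.

(** * Coloured words whose classes all have size [b] *)

Definition colour_class (n k : nat) (c : {ffun 'I_n -> 'I_k}) (a : 'I_k) : seq 'I_n :=
  enum [pred j | c j == a].

Lemma mem_colour_class (n k : nat) (c : {ffun 'I_n -> 'I_k}) (a : 'I_k) (i : 'I_n) :
  (i \in colour_class c a) = (c i == a).
Proof. by rewrite mem_enum. Qed.

Definition balanced (k b : nat) : {set {ffun 'I_(k * b) -> 'I_k}} :=
  [set c | [forall a, size (colour_class c a) == b]].

Lemma colour_class_index_lt (k b : nat) (c : {ffun 'I_(k * b) -> 'I_k}) (i : 'I_(k * b)) :
  c \in balanced k b -> index i (colour_class c (c i)) < b.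
Proof.
rewrite inE => /forallP/(_ (c i))/eqP Hs.
by rewrite -[X in _ < X]Hs index_mem mem_colour_class.
Qed.

Lemma colour_class_index_surj (k b : nat) (c : {ffun 'I_(k * b) -> 'I_k}) (a : 'I_k) (r : 'I_b) :
  c \in balanced k b -> exists2 i, c i = a & index i (colour_class c a) = r.
Proof.
rewrite inE => /forallP/(_ a)/eqP Hs; have Hr := ltn_ord r; rewrite -[X in _ < X]Hs in Hr.
have [i0 _] : exists i0, i0 \in colour_class c a.
  by case: (colour_class c a) Hr => // i0 s _; exists i0; rewrite mem_head.
exists (nth i0 (colour_class c a) r); last by rewrite index_uniq ?enum_uniq.
by apply/eqP; rewrite -mem_colour_class mem_nth.
Qed.

Lemma colour_class_index_homo (n k : nat) (c : {ffun 'I_n -> 'I_k}) (i j : 'I_n) :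
  c i = c j -> i < j ->
  index i (colour_class c (c i)) <= index j (colour_class c (c i)).
Proof.
move=> cij ij; rewrite leqNgt; apply/negP => H.
have Hs : sorted (relpre val ltn) (colour_class c (c i)).
  rewrite /colour_class /enum_mem -enumT; apply: sorted_filter.
    by move=> x y z; apply: ltn_trans.
  by rewrite -sorted_map val_enum_ord iota_ltn_sorted.
have tr : transitive (relpre (val : 'I_n -> nat) ltn) by move=> x y z; apply: ltn_trans.
have /(_ j i) := sorted_ltn_index tr Hs.
rewrite !mem_colour_class cij eqxx -cij => /(_ isT isT H) /=.
by rewrite ltnNge (ltnW ij).
Qed.

(** One weakly increasing [b]-tuple of letters is written along each class of a balanced colouring;
    this is injective because every tuple entry gets used. *)
Lemma balanced_bin_le_ncoloured (k b A : nat) :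
  #|balanced k b| * 'C(b + A, b) ^ k <= ncoloured (k * b) k A.+1.
Proof.
rewrite -card_sorted_tuples -[k in _ ^ k]card_ord -card_ffun_on -cardX /ncoloured.
pose F (cy : {ffun 'I_(k * b) -> 'I_k} * {ffun 'I_k -> b.-tuple 'I_A.+1}) :=
  (cy.1, [ffun i => nth ord0 (cy.2 (cy.1 i)) (index i (colour_class cy.1 (cy.1 i)))]).
rewrite -(@card_in_imset _ _ F).
  apply/subset_leq_card/fintype.subsetP => cx /imsetP[[c y]].
  rewrite inE /= => /andP[Hc /ffun_onP Hy] ->; rewrite /F /=.
  apply/increasing_on_classesP => i j ij cij; rewrite !ffunE -cij.
  have := Hy (c i); rewrite inE => Hs.
  have := sorted_leq_nth leq_trans leqnn 0 Hs.
  have ib := colour_class_index_lt i Hc; have jb := colour_class_index_lt j Hc.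
  rewrite -cij in jb.
  move=> /(_ _ _ _ _ (colour_class_index_homo cij ij)).
  rewrite !inE size_map size_tuple => /(_ ib jb).
  by rewrite !(nth_map ord0) ?size_tuple.
move=> [c y] [d z]; rewrite inE /= => /andP[Hc _] _ [ecd]; rewrite -{}ecd => e.
congr (_, _); apply/ffunP => a; apply: eq_from_tnth => r.
have [i ci Hi] := colour_class_index_surj a r Hc.
have := congr1 (fun f : {ffun _ -> _} => f i) e.
by rewrite /= !ffunE ci Hi -!tnth_nth.
Qed.

(** A bijection from positions to (colour, rank) pairs is determined by its colour component, which
    is balanced, and the permutation of ranks read along each class. *)
Lemma fact_le_balanced (k b : nat) : (k * b)`! <= #|balanced k b| * b`! ^ k.
Proof.
have card_inj : #|[set f : {ffun 'I_(k * b) -> 'I_k * 'I_b} | injectiveb f]| = (k * b)`!.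
  by rewrite card_inj_ffuns card_prod !card_ord ffactnn.
have <- : #|[set f : {ffun 'I_b -> 'I_b} | injectiveb f]| = b`!.
  by rewrite card_inj_ffuns !card_ord ffactnn.
rewrite -card_inj -[k in _ ^ k]card_ord -card_ffun_on -cardX.
pose col (f : {ffun 'I_(k * b) -> 'I_k * 'I_b}) : {ffun 'I_(k * b) -> 'I_k} :=
  [ffun i => (f i).1].
(* ['I_b] may be empty, so the index [r] itself serves as default; for injective [f] it is never
   reached. *)
pose F (f : {ffun 'I_(k * b) -> 'I_k * 'I_b}) := (col f,
  [ffun a : 'I_k => [ffun r : 'I_b => nth r [seq (f i).2 | i <- colour_class (col f) a] r]]).
have Hcol (f : {ffun 'I_(k * b) -> 'I_k * 'I_b}) : injectiveb f -> col f \in balanced k b.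
  move=> /injectiveP f_inj; rewrite inE; apply/forallP => a.
  have [g fK gK] : bijective f by apply: inj_card_bij => //; rewrite card_prod !card_ord.
  rewrite -cardE -cardsE -(card_imset _ f_inj).
  suff -> : f @: [set j | col f j == a] = finset.setX [set a] [set: 'I_b].
    by rewrite cardsX cards1 cardsT card_ord mul1n.
  apply/setP => -[u v]; rewrite !inE andbT /=; apply/imsetP/idP => [[j]|/eqP->].
    by rewrite inE ffunE => /eqP <- <-.
  by exists (g (a, v)); rewrite ?inE ?ffunE gK.
rewrite -(@card_in_imset _ _ F).
  apply/subset_leq_card/fintype.subsetP => cy /imsetP[f]; rewrite inE => Hf ->.
  rewrite inE /= Hcol //=; apply/ffun_onP => a; rewrite ffunE inE; apply/injectiveP => r s.
  have := Hcol f Hf; rewrite inE => /forallP/(_ a)/eqP Hs.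
  rewrite !ffunE => /eqP.
  rewrite [nth s _ s](set_nth_default r) ?size_map ?Hs //.
  rewrite nth_uniq ?size_map ?Hs // => [/eqP/val_inj //|].
  rewrite map_inj_in_uniq ?enum_uniq // => i j; rewrite !mem_colour_class !ffunE.
  move=> /eqP ei /eqP ej e; apply: (injectiveP _ Hf).
  by rewrite [f i]surjective_pairing [f j]surjective_pairing e ei ej.
move=> f g; rewrite !inE => Hf Hg [ec e]; apply/ffunP => i.
have Hi := colour_class_index_lt i (Hcol f Hf).
have E1 : (f i).1 = (g i).1 by have := congr1 (fun h : {ffun _ -> _} => h i) ec; rewrite !ffunE.
rewrite [f i]surjective_pairing [g i]surjective_pairing E1; congr (_, _).
have H a r : nth r [seq (f i).2 | i <- colour_class (col f) a] r =
             nth r [seq (g i).2 | i <- colour_class (col f) a] r.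
  have /(congr1 (fun h : {ffun _ -> _} => h r)) :=
    congr1 (fun h : {ffun _ -> {ffun _ -> _}} => h a) e.
  by rewrite -ec !ffunE.
have := H (col f i) (Ordinal Hi).
by rewrite !(nth_map i) ?index_mem ?mem_colour_class //= nth_index ?mem_colour_class.
Qed.

Local Open Scope ring_scope.

(** * Logarithms and Stirling-type bounds *)

Lemma ln_subr_le (R : realType) (x y : R) : 0 < x -> 0 < y -> ln x - ln y <= x / y - 1.
Proof.
move=> x0 y0; rewrite -ln_div ?posrE //.
have xy0 : 0 < x / y by rewrite divr_gt0.
have H : -1 < x / y - 1 by lra.
by have := le_ln1Dx H; rewrite addrC subrK.
Qed.

Lemma ln_natM (R : realType) (m n : nat) : (0 < m)%N -> (0 < n)%N ->
  ln (m * n)%N%:R = ln m%:R + ln n%:R :> R.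
Proof. by move=> m0 n0; rewrite natrM lnM // posrE ltr0n. Qed.

Lemma ln_natX (R : realType) (m n : nat) : (0 < m)%N ->
  ln (m ^ n)%N%:R = n%:R * ln m%:R :> R.
Proof. by move=> m0; rewrite natrX lnXn ?ltr0n // mulr_natl. Qed.

Lemma ler_ln_nat (R : realType) (m n : nat) : (0 < m)%N -> (m <= n)%N ->
  ln m%:R <= ln n%:R :> R.
Proof.
move=> m0 mn; rewrite ler_ln ?posrE ?ltr0n ?ler_nat //; exact: leq_trans mn.
Qed.

(** The induction step amounts to [x * (ln (x + 1) - ln x) <= 1]. *)
Lemma ln_fact_ge (R : realType) (n : nat) : (0 < n)%N ->
  n%:R * ln n%:R - n%:R <= ln n`!%:R :> R.
Proof.
elim: n => // -[_ _|n IH _]; first by rewrite ln1; lra.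
rewrite factS ln_natM ?fact_gt0 //.
have {IH} := IH isT; set x := n.+1%:R : R.
have x0 : 0 < x by rewrite ltr0n.
have -> : n.+2%:R = x + 1 :> R by rewrite -natr1.
have := ler_wpM2l (ltW x0) (ln_subr_le (addr_gt0 x0 ltr01) x0).
have -> : x * ((x + 1) / x - 1) = 1 by field; lra.
lra.
Qed.

(** The induction step amounts to [(x + 1) * (ln x - ln (x + 1)) <= -1]. *)
Lemma ln_fact_le (R : realType) (n : nat) : (0 < n)%N ->
  ln n`!%:R <= n%:R * ln n%:R - n%:R + 1 + ln n%:R :> R.
Proof.
elim: n => // -[_ _|n IH _]; first by rewrite ln1; lra.
rewrite factS ln_natM ?fact_gt0 //.
have {IH} := IH isT; set x := n.+1%:R : R.
have x0 : 0 < x by rewrite ltr0n.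
have -> : n.+2%:R = x + 1 :> R by rewrite -natr1.
have x1 : 0 < x + 1 by lra.
have := ler_wpM2l (ltW x1) (ln_subr_le x0 x1).
have -> : (x + 1) * (x / (x + 1) - 1) = - 1 by field; lra.
lra.
Qed.

(** * Growth rate of the number of coloured words *)

(** For positive [k], the logarithm of the claimed limit. *)
Definition log_growth (R : realType) (k : nat) : R :=
  k.+1%:R * ln k.+1%:R - k.-1%:R * ln k%:R.

(** The two preceding counts multiplied, with the binomial in factorials and denominators cleared to
    stay in [nat]. *)
Lemma ncoloured_ge (k b : nat) :
  ((k * b)`! * (k.+1 * b)`! ^ k <=
   ncoloured (k * b) k (k * b).+1 * (b`! ^ k * b`! ^ k * (k * b)`! ^ k))%N.
Proof.
have -> : ((k.+1 * b)`! = 'C(b + k * b, b) * (b`! * (k * b)`!))%N.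
  by have := bin_fact (leq_addr (k * b) b); rewrite addKn mulSn => ->.
rewrite !expnMn; set C := ('C(_, _) ^ k)%N; set u := (b`! ^ k)%N; set v := (_ ^ k)%N.
have H1 := leq_mul (fact_le_balanced k b) (leqnn C).
have H2 := leq_mul (balanced_bin_le_ncoloured k b (k * b)) (leqnn u).
have H3 : ((k * b)`! * C <= ncoloured (k * b) k (k * b).+1 * u)%N.
  by apply: leq_trans H1 _; rewrite mulnAC.
by have := leq_mul H3 (leqnn (u * v)%N); rewrite !mulnA.
Qed.

Lemma ncoloured_gt0 (k b : nat) : (0 < ncoloured (k * b) k (k * b).+1)%N.
Proof.
rewrite lt0n; apply/negP => /eqP e; have := ncoloured_ge k b.
by rewrite e mul0n leqNgt muln_gt0 expn_gt0 !fact_gt0.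
Qed.

(** The error comes from the upper Stirling bounds: [k] uses for [(k * b)!] and [2k] for [b!], each
    costing 1 plus a logarithm. *)
Lemma ln_ncoloured_ge (R : realType) (k b : nat) : (0 < k)%N -> (0 < b)%N ->
  (k * b)%N%:R * log_growth R k - k%:R * (3 + 3 * ln b%:R + ln k%:R) <=
  ln (ncoloured (k * b) k (k * b).+1)%:R.
Proof.
move=> k0 b0; have N0 := ncoloured_gt0 k b.
have := @ler_ln_nat R _ _ _ (ncoloured_ge k b).
have kb0 : (0 < k * b)%N by rewrite muln_gt0 k0.
have kb1 : (0 < k.+1 * b)%N by rewrite muln_gt0.
rewrite !(ln_natM, ln_natX) ?muln_gt0 ?expn_gt0 ?fact_gt0 // => /(_ isT).
move: (ln_fact_ge R kb1) (ln_fact_le R kb0) (ln_fact_ge R kb0) (ln_fact_le R b0).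
rewrite /log_growth !ln_natM //.
have -> : k.-1%:R = k%:R - 1 :> R by rewrite -subn1 natrB.
rewrite !natrM -[k.+1%:R]natr1.
move: (ln (ncoloured _ _ _)%:R) (ln (k * b)`!%:R) (ln b`!%:R) (ln (_)`!%:R) => N F G H.
move: (ln k%:R) (ln b%:R) (ln _) => lk lb lk1.
have : 0 <= k%:R :> R by [].
move: (k%:R : R) (b%:R : R) => x y x0 h1 h2 h3 h4 h5.
have := ler_wpM2l x0 h1; have := ler_wpM2l x0 h2; have := ler_wpM2l x0 h4.
lra.
Qed.

Lemma ln_ncoloured_rate (R : realType) (k : nat) (e : R) : (0 < k)%N -> 0 < e ->
  exists2 b : nat, (0 < b)%N &
    (log_growth R k - e) * (k * b).+1%:R <= ln (ncoloured (k * b) k (k * b).+1)%:R.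
Proof.
(* With [b = s ^ 2] and [ln s <= s], the error is at most [X + 6ks <= s * D], against a gain of
   [e * k * s ^ 2]. The [log_growth] in [X] pays for the [+ 1] in the block length. *)
move=> k0 e0; pose X := log_growth R k + k%:R * (3 + ln k%:R); pose D := X + 6 * k%:R.
have k1 : 1 <= k%:R :> R by rewrite ler1n.
have ke0 : 0 < e * k%:R by rewrite mulr_gt0 // ltr0n.
pose s := (Num.bound (D / (e * k%:R))).+1.
have Ds : D <= s%:R * (e * k%:R).
  rewrite -ler_pdivrMr //; apply: ltW.
  by apply: lt_le_trans (unstable.ltr_bound _) _; rewrite ler_nat.
have s1 : 1 <= s%:R :> R by rewrite ler1n.
exists (s ^ 2)%N => //; apply: le_trans (ln_ncoloured_ge R k0 _) => //.
have lns : ln s%:R <= s%:R :> R.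
  have := @ln_subr_le R s%:R 1 _ ltr01; rewrite ltr0n => /(_ isT).
  by rewrite ln1 divr1; lra.
rewrite ln_natX // -[(k * _).+1%:R]natr1 natrM natrX.
have X0 : 0 <= X.
  have G0 : 0 <= log_growth R k.
    rewrite /log_growth subr_ge0.
    apply: ler_pM; rewrite ?ln_ge0 ?ler_ln_nat //.
    by rewrite ler_nat (leq_trans (leq_pred k)).
  by apply: addr_ge0 G0 _; rewrite mulr_ge0 // addr_ge0 // ln_ge0.
have XsX : X <= s%:R * X by rewrite ler_peMl.
have ks : k%:R * ln s%:R <= k%:R * s%:R :> R by rewrite ler_wpM2l.
have := ler_wpM2l (le_trans ler01 s1) Ds.
rewrite /D; move: XsX; rewrite /X; lra.
Qed.

(** * The limit *)

Lemma ln_wnk_le (R : realType) (n k : nat) : (0 < k)%N ->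
  ln (wnk n k)%:R <= n%:R * log_growth R k.
Proof.
move=> k0; have w0 := wnk_gt0 n k0.
have := @ler_ln_nat R _ _ _ (wnk_upper n k0).
rewrite ln_natM ?expn_gt0 ?k0 // !ln_natX // muln_gt0 w0 expn_gt0 k0 => /(_ isT).
rewrite /log_growth !natrM; lra.
Qed.

Lemma ln_wnk_ge (R : realType) (n k b : nat) : (0 < k)%N -> (0 < b)%N ->
  (k * (k * b).+1 <= n)%N ->
  n%:R * (ln (ncoloured (k * b) k (k * b).+1)%:R / (k * b).+1%:R)
    - k.+1%:R * ln (ncoloured (k * b) k (k * b).+1)%:R <= ln (wnk n k)%:R :> R.
Proof.
move=> k0 b0; set A := (k * b).+1; set N := ln (ncoloured _ _ _)%:R => kn.
(* The largest [T] with [(T + k) * A <= n]; rounding and the [k] extra alphabet blocks lose at most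
   [k.+1] factors. *)
pose T := (n %/ A - k)%N.
have Tk : (T + k = n %/ A)%N by rewrite subnK // leq_divRL.
have TA : ((T + k) * A <= n)%N by rewrite Tk leq_divM.
have nT : (n <= (T + k.+1) * A)%N by rewrite addnS Tk ltnW // ltn_ceil.
have TB : (T * (k * b) <= n)%N.
  by apply: leq_trans TA; apply: leq_mul; rewrite ?leq_addr ?leqnSn.
have kb0 : (0 < k * b)%N by rewrite muln_gt0 k0.
have := @ler_ln_nat R _ _ _ (ncoloured_pow_le_wnk k0 kb0 (ltn0Sn _) TA TB).
rewrite expn_gt0 ncoloured_gt0 ln_natX ?ncoloured_gt0 // -/A -/N => /(_ isT).
apply: le_trans.
have N0 : 0 <= N by rewrite ln_ge0 // ler1n ncoloured_gt0.
have A0 : 0 < A%:R :> R by rewrite ltr0n.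
have : n%:R <= (T%:R + k.+1%:R) * A%:R :> R by rewrite -natrD -natrM ler_nat.
move/(ler_wpM2r (divr_ge0 N0 (ltW A0))).
have -> : (T%:R + k.+1%:R) * A%:R * (N / A%:R) = T%:R * N + k.+1%:R * N.
  by rewrite -mulrA (mulrC A%:R) divfK ?lt0r_neq0 // mulrDl.
lra.
Qed.

Import numFieldNormedType.Exports.

(** The upper bound holds for every [n]. Below, half of [e] is spent on fixing [b]; the other half
    absorbs the term [k.+1 * N] once [n] is large. *)
Lemma ln_wnk_cvg (R : realType) (k : nat) : (0 < k)%N ->
  ((fun n => n%:R^-1 * ln (wnk n k)%:R : R) @ \oo --> log_growth R k)%classic.
Proof.
move=> k0; apply/cvgrPdist_le => e e0; have e20 : 0 < e / 2 by lra.
have [b b0] := ln_ncoloured_rate k0 e20.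
set A := (k * b).+1; set N := ln _ => HN.
near=> n.
have n0 : 0 < n%:R :> R by near: n; exact: nbhs_infty_gtr.
have nkA : (k * A <= n)%N by near: n; exact: nbhs_infty_ge.
have nN : k.+1%:R * N / (e / 2) <= n%:R by near: n; exact: nbhs_infty_ger.
have A0 : 0 < A%:R :> R by rewrite ltr0n.
rewrite ler_pdivrMr // in nN; rewrite -ler_pdivlMr // in HN.
have H1 := ln_wnk_le R n k0; have := ln_wnk_ge R k0 b0 nkA; rewrite -/A -/N => H2.
have H3 := ler_wpM2l (ltW n0) HN.
rewrite mulrC ler_norml; apply/andP; split.
  have : ln (wnk n k)%:R / n%:R <= log_growth R k by rewrite ler_pdivrMr // mulrC.
  lra.
have : log_growth R k - e <= ln (wnk n k)%:R / n%:R by rewrite ler_pdivlMr //; lra.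
lra.
Unshelve. all: by end_near.
Qed.

Lemma expR_log_growth (R : realType) (k : nat) : (0 < k)%N ->
  expR (log_growth R k) = k.+1%:R ^+ k.+1 / k%:R ^+ k.-1.
Proof.
by move=> k0; rewrite expRB !expRM_natl !lnK // posrE ltr0n.
Qed.

Theorem theorem3p4 (R : realType) (k : nat) (hk : (0 < k)%N) :
  let u : R^o^nat := fun n => ((wnk n k)%:R) `^ (n%:R^-1) in
  cvgn u /\
  limn_sup u = ((k.+1)%:R ^+ k.+1) / ((k%:R) ^+ k.-1).
Proof.
move=> u.
have u_cvg : (u @ \oo --> (k.+1%:R ^+ k.+1 / k%:R ^+ k.-1 : R^o))%classic.
  rewrite -expR_log_growth //.
  (* Positivity of [wnk n k] selects the exponential branch of [powR]. *)
  have -> : u = (fun n => expR (n%:R^-1 * ln (wnk n k)%:R)).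
    by apply/funext => n; rewrite /u /powR pnatr_eq0 -[_ == 0%N]negbK -lt0n wnk_gt0.
  by apply: continuous_cvg; [exact: continuous_expR | exact: ln_wnk_cvg].
have u_is_cvg : cvgn u by apply/cvg_ex; eexists; exact: u_cvg.
by split=> //; rewrite cvg_limn_supE //; exact: cvg_lim u_cvg.
Qed.
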